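(* Let $(\Omega,\mathcal F)$ be a measurable space, let $\mathcal P\subseteq\mathcal M_1$ be nonempty and arbitrary, and let $\mathcal Q\subseteq\mathcal M_1$ be nonempty, convex and setwise compact. Then $$\mathsf G=\mathsf G_b=\min_{\mathsf Q\in\mathcal Q}\ \min_{\mathsf P\in\mathcal P_{\mathrm{eff}}}H(\mathsf Q\mid\mathsf P),$$ where $\mathsf G=\sup_{X\in\mathcal E}\inf_{\mathsf Q\in\mathcal Q}\mathbb E_{\mathsf Q}[\log X]$ and $\mathsf G_b=\sup_{X\in\mathcal E_b}\inf_{\mathsf Q\in\mathcal Q}\mathbb E_{\mathsf Q}[\log X]$.
   Context: $\mathcal M$, $\mathcal M_+$, $\mathcal M_1$ are the sets of finite signed (countably additive) measures, finite nonnegative measures, and probability measures on $\mathcal F$. An e-variable for $\mathcal P$ is a measurable $X:\Omega\to[0,\infty]$ with $\int X\,d\mathsf P\le1$ for all $\mathsf P\in\mathcal P$; $\mathcal E$ is the set of all e-variables and $\mathcal E_b$ the subset of those bounded from above, $\sup_\omega X(\omega)<\infty$. The effective null is $\mathcal P_{\mathrm{eff}}=\{\mathsf P\in\mathcal M_+:\int X\,d\mathsf P\le1\text{ for all }X\in\mathcal E\}$. Conventions: $\log0=-\infty$, $\log\infty=\infty$; $\mathbb E_{\mathsf Q}[\log X]=\mathbb E_{\mathsf Q}[(\log X)^+]-\mathbb E_{\mathsf Q}[(\log X)^-]$ if $\mathbb E_{\mathsf Q}[(\log X)^-]<\infty$, and $=-\infty$ if $\mathbb E_{\mathsf Q}[(\log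 X)^-]=\infty$. For $\mathsf Q\in\mathcal M_1$, $\mathsf P\in\mathcal M_+$: $H(\mathsf Q\mid\mathsf P)=\int\log(d\mathsf Q/d\mathsf P)\,d\mathsf Q$ if $\mathsf Q\ll\mathsf P$ and $=\infty$ otherwise. The setwise topology on $\mathcal M$ is $\sigma(\mathcal M,\mathcal B_b)$, the initial topology of the maps $\mathsf R\mapsto\int f\,d\mathsf R$, $f\in\mathcal B_b$, where $\mathcal B_b$ is the set of bounded measurable functions $\Omega\to\mathbb R$; ''setwise compact'' means compact in this topology. *)

(* Defs.v *)
From HB Require Import structures.
From mathcomp Require Import all_boot all_order all_algebra.
From mathcomp Require Import all_classical all_reals all_analysis measurable_realfun.

Set Implicit Arguments.
Unset Strict Implicit.
Unset Printing Implicit Defensive.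

Import Order.TTheory GRing.Theory Num.Theory.
Import numFieldNormedType.Exports.

Local Open Scope classical_set_scope.
Local Open Scope ring_scope.
Local Open Scope ereal_scope.
Local Open Scope charge_scope.

(* A library measure or charge is a function on all sets, with arbitrary values
   on non-measurable sets, so a countably additive set function on the
   sigma-algebra may have several representatives. Every notion below depends
   only on the values on measurable sets; in particular a set of measures need
   not contain all the representatives of its elements. *)

Section setwise_topology.
Context d (T : measurableType d) (R : realType).

(* The integral against a finite signed measure, by its Jordan decomposition;
   it does not depend on the Hahn decomposition that is chosen. *)
Definition charge_integral (nu : {charge set T -> \bar R}) (f : T -> R) : R :=
  let nuPN := svalP (cid (svalP (cid (Hahn_decomposition nu)))) in
  (\int[jordan_pos nuPN]_x f x - \int[jordan_neg nuPN]_x f x)%R.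

Definition bounded_measurable : Type :=
  {f : T -> R | measurable_fun setT f /\ bounded_fun f}.

Definition signed_measure : Type := {charge set T -> \bar R}.

HB.instance Definition _ := gen_eqMixin signed_measure.
HB.instance Definition _ := gen_choiceMixin signed_measure.

Definition setwise : Type :=
  sup_topology (fun f : bounded_measurable =>
    Topological.on (initial_topology (fun nu : signed_measure =>
      charge_integral nu (sval f)))).

HB.instance Definition _ := Topological.on setwise.

Definition setwise_compact (QQ : set (probability T R)) : Prop :=
  @compact setwise
    [set (charge_of_finite_measure Q : {charge set T -> \bar R}) | Q in QQ].

End setwise_topology.

Section e_variables.
Context d (T : measurableType d) (R : realType).
Implicit Types (PP QQ : set (probability T R)) (X : T -> \bar R).

Definition convex_probabilities QQ : Prop :=
  forall Q1 Q2 (t : R), QQ Q1 -> QQ Q2 -> (0 <= t <= 1)%R ->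
  exists2 Q, QQ Q & forall A, measurable A ->
    Q A = t%:E * Q1 A + (1 - t)%:E * Q2 A.

Definition e_variables PP : set (T -> \bar R) :=
  [set X : T -> \bar R | [/\ measurable_fun setT X, forall w, 0 <= X w &
               forall P, PP P -> \int[P]_w X w <= 1]].

Definition bounded_e_variables PP : set (T -> \bar R) :=
  e_variables PP `&` [set X : T -> \bar R | ereal_sup (range X) < +oo].

Definition effective_null PP : set {finite_measure set T -> \bar R} :=
  [set P : {finite_measure set T -> \bar R} |
     forall X, e_variables PP X -> \int[P]_w X w <= 1].

Definition expected_log (Q : probability T R) X : \bar R :=
  let logX w := lne (X w) in
  if \int[Q]_w (logX^\- w) == +oo then -oo
  else \int[Q]_w (logX^\+ w) - \int[Q]_w (logX^\- w).

(* The library derivative may be nonpositive, but only on a Q-null set. *)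
Definition relative_entropy (Q : probability T R)
    (P : {finite_measure set T -> \bar R}) : \bar R :=
  if `[< Q `<< P >] then
    \int[Q]_w lne (('d (charge_of_finite_measure Q) '/d P) w)
  else +oo.

Definition maxmin_log_growth (XX : set (T -> \bar R)) QQ : \bar R :=
  ereal_sup [set ereal_inf [set expected_log Q X | Q in QQ] | X in XX].

End e_variables.

Definition is_minimum (R : realType) (A : set (\bar R)) (m : \bar R) : Prop :=
  A m /\ lbound A m.

(* Main.v *)
Require Import Defs.
From HB Require Import structures.
From mathcomp Require Import all_boot all_order all_algebra.
From mathcomp Require Import all_classical all_reals all_analysis measurable_realfun.
From mathcomp Require Import finmap ring lra.

(** Call an e-variable tame if it is bounded and bounded away from 0, and for a
    probability measure [Q] let [g Q] be the supremum of the [Q]-expectations of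
    [ln X] over tame [X]. The theorem follows from three facts.

    Weak duality ([weak_duality]). If [P] is effective and [F] is the density of
    [Q] in [P], then [ln X - ln F <= X / F - 1], and the [Q]-integral of [X / F]
    is at most the [P]-integral of [X], which is at most 1. So the expected
    logarithm of any e-variable [X] under [Q] is at most the relative entropy.

    Strong duality for one [Q] ([strong_duality]). Suppose [g Q] is finite and take
    a maximizing sequence of tame e-variables. Midpoints of its terms are
    e-variables too, and the logarithm is strictly concave, so consecutive terms
    must be close ([near_optimal_distance]); along a fast maximizing sequence the
    logarithms converge [Q]-almost everywhere, to [ln S] with [S] positive and
    finite ([near_optimal_cvg]). First-order optimality of the sequence gives in the
    limit that [X / S] has [Q]-expectation at most 1 for every tame [X]
    ([numeraire_tame]), which means that the measure [P] with density [1 / S] in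
    [Q] is effective ([effective_of_tame]). The entropy of [Q] relative to it is
    the [Q]-expectation of [ln S], at most [g Q] by Fatou's lemma
    ([numeraire_log]). With weak duality, [g Q] is the minimum of the relative
    entropy over effective [P] ([tame_growth_minimum]); when [g Q] is infinite
    every effective [P] attains it.

    Minimax ([log_growth_minimax]). For tame [X] the expectation of [ln X] is affine
    and setwise continuous in [Q], and it is concave in [X]. If every [Q] in the
    compact set has a tame [X] with value above [c], compactness leaves finitely
    many [X] to consider, and an elementary finite minimax lemma combines them
    into a single tame [X] whose value exceeds [c] uniformly in [Q]. This is
    impossible for [c] the value for bounded e-variables, so some [Q0] has
    [g Q0] at most that value; weak duality bounds the value for all e-variables by
    [g Q0], and the three quantities coincide. *)

Set Implicit Arguments.
Unset Strict Implicit.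
Unset Printing Implicit Defensive.

Import Order.TTheory GRing.Theory Num.Theory.
Import numFieldNormedType.Exports.

Local Open Scope classical_set_scope.
Local Open Scope ring_scope.

(** * Minimax for finitely many functions *)

Section finite_minimax.
Context {R : realType} {S : Type}.
Implicit Types (A : set S) (F : set (S -> R)) (f g : S -> R).

(** Convexity of [A] as seen through the functions in [F], which are affine
    along the mixtures: [S] itself carries no linear structure, just as
    probability measures here do not form a vector space. *)
Definition jointly_convex A F := forall s1 s2 (t : R), A s1 -> A s2 -> 0 <= t <= 1 ->
  exists2 s, A s & forall f, F f -> f s = t * f s1 + (1 - t) * f s2.

Definition concavely_closed A F := forall f g (t : R), F f -> F g -> 0 <= t <= 1 ->
  exists2 h, F h & forall s, A s -> t * f s + (1 - t) * g s <= h s.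

(** Separation of a planar convex set from the open negative quadrant.
    Points with [f s < 0] bound the weight [t] from above by
    [g s / (g s - f s)] and points with [g s < 0] bound it from below; if these
    bounds were incompatible, the segment between the two offending points would
    cross the open negative quadrant. *)
Lemma planar_separation A f g : jointly_convex A [set f; g] ->
  (forall s, A s -> 0 <= f s \/ 0 <= g s) ->
  exists2 t : R, 0 <= t <= 1 & forall s, A s -> 0 <= t * f s + (1 - t) * g s.
Proof.
move=> cvxA fg0.
pose B := [set g s / (g s - f s) | s in [set s | A s /\ f s < 0]].
have Bge0 x : B x -> 0 <= x.
  move=> [s [As fs] <-]; have [|g0] := fg0 s As; first by rewrite leNgt fs.
  by rewrite divr_ge0 //; lra.
have [[s0 [As0 fs0]]|noneg] := pselect (exists s, A s /\ f s < 0); last first.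
  exists 1; first by rewrite ler01 lexx.
  move=> s As; rewrite subrr mul0r addr0 mul1r leNgt; apply/negP => fs.
  by apply: noneg; exists s.
have Bs0 : B (g s0 / (g s0 - f s0)) by exists s0.
have Blb : has_lbound B by exists 0 => x /Bge0.
have inf0 : 0 <= inf B.
  by apply: lb_le_inf; [exists (g s0 / (g s0 - f s0))|exact: Bge0].
have infB x : B x -> inf B <= x by move=> Bx; exact: ge_inf.
exists (inf B).
  rewrite inf0 (le_trans (infB _ Bs0))//.
  have [|g0] := fg0 s0 As0; first by rewrite leNgt fs0.
  by rewrite ler_pdivrMr; lra.
move=> s As; have [fs|fs] := ltP (f s) 0.
  have [|g0] := fg0 s As; first by rewrite leNgt fs.
  have : inf B <= g s / (g s - f s) by apply: infB; exists s.
  by rewrite ler_pdivlMr; nra.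
have [gs|gs] := ltP (g s) 0; last first.
  rewrite addr_ge0 ?mulr_ge0// subr_ge0.
  apply: (le_trans (infB _ Bs0)).
  have [|g0] := fg0 s0 As0; first by rewrite leNgt fs0.
  by rewrite ler_pdivrMr; lra.
suff : - g s / (f s - g s) <= inf B by rewrite ler_pdivrMr; nra.
apply: lb_le_inf; first by exists (g s0 / (g s0 - f s0)).
move=> _ [s1 [As1 fs1] <-].
have [|g1] := fg0 s1 As1; first by rewrite leNgt fs1.
rewrite ler_pdivrMr; last by lra.
rewrite mulrAC ler_pdivlMr; last by lra.
suff : f s1 * g s <= g s1 * f s by lra.
rewrite leNgt; apply/negP => lt1.
(* the weight [t] is the one at which both coordinates of the mixture of [s1]
   and [s] are equal *)
have den : 0 < (f s - f s1) + (g s1 - g s) by lra.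
pose t := (f s - g s) / ((f s - f s1) + (g s1 - g s)).
have t01 : 0 <= t <= 1.
  by rewrite divr_ge0 ?ler_pdivrMr/=; lra.
have [s2 As2 E] := cvxA s1 s t As1 As t01.
have := fg0 s2 As2; rewrite !E; [|by right|by left].
have tden : t * ((f s - f s1) + (g s1 - g s)) = f s - g s.
  by rewrite /t mulfVK// gt_eqF.
have mixlt p p1 : p * (g s1 - f s1) + p1 * (f s - g s) < 0 ->
    t * p1 + (1 - t) * p < 0.
  move=> H; rewrite -(pmulr_llt0 _ den); apply: le_lt_trans H.
  rewrite -tden -subr_ge0.
  rewrite [leRHS](_ : _ =
    p * (t * ((f s - f s1) + (g s1 - g s)) - (f s - g s))); last by ring.
  by rewrite tden subrr mulr0.
have l1 : t * f s1 + (1 - t) * f s < 0 by apply: mixlt; lra.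
have l2 : t * g s1 + (1 - t) * g s < 0 by apply: mixlt; lra.
by case; lra.
Qed.

(** Induction on the number of functions: on the convex subset where [f] is below
    [c], the remaining functions already have a combination [h] above [c], so
    that [f] and [h] together satisfy the hypothesis of planar separation. That
    subset need not be closed, which is why [A] is an arbitrary convex set and
    the inequalities are weak. *)
Lemma finite_minimax A F (c : R) (fs : seq (S -> R)) f0 : F f0 ->
  jointly_convex A F -> concavely_closed A F -> {subset fs <= F} ->
  (forall s, A s -> exists2 f, f \in fs & c <= f s) ->
  exists2 h, F h & forall s, A s -> c <= h s.
Proof.
move=> Ff0.
elim: fs A => [A _ _ _ cov|f fs IH A cvxA concF inF cov].
  by exists f0 => // s /cov[].
have Ff : F f by apply/set_mem/inF; rewrite inE eqxx.
pose A' := [set s | A s /\ f s < c].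
have [||||h Fh hc] := IH A'.
- move=> s1 s2 t [As1 fs1] [As2 fs2] t01; have [s As E] := cvxA s1 s2 t As1 As2 t01.
  exists s => //; split => //; rewrite E//; case/andP: t01 => t0 t1.
  have m : Num.max (f s1) (f s2) < c by rewrite gt_max fs1.
  apply: le_lt_trans m; set m := Num.max _ _.
  have m1 : f s1 <= m by rewrite /m le_max lexx.
  have m2 : f s2 <= m by rewrite /m le_max lexx orbT.
  by nra.
- move=> f1 g1 t F1 G1 t01; have [h Fh hE] := concF f1 g1 t F1 G1 t01.
  by exists h => // s [As _]; exact: hE.
- by move=> g gfs; apply: inF; rewrite inE gfs orbT.
- move=> s [As fsc]; have [g + cg] := cov s As.
  rewrite inE => /predU1P[gf|]; last by exists g.
  by move: cg; rewrite gf leNgt fsc.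
have [||t t01 tE] := @planar_separation A (fun s => f s - c) (fun s => h s - c).
- move=> s1 s2 t As1 As2 t01; have [s As E] := cvxA s1 s2 t As1 As2 t01.
  by exists s => // _ [->|->]; rewrite /= E//; ring.
- move=> s As; rewrite !subr_ge0; have [|fsc] := leP c (f s); first by left.
  by right; apply: hc.
have [k Fk kE] := concF f h t Ff Fh t01.
exists k => // s As; apply: le_trans (kE s As).
by have := tE s As; lra.
Qed.

End finite_minimax.

(** * Inequalities for the logarithm *)

Section real_inequalities.
Context {R : realType}.
Implicit Types x y : R.

(** Quantitative strict concavity of the logarithm: the right-hand side is
    [- ln a] for [a] the squared ratio of the geometric to the arithmetic mean,
    and [- ln a] is at least [1 - a], which is the left-hand side. *)
Lemma ln_midpoint x y : 0 < x -> 0 < y ->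
  ((x - y) / (x + y)) ^+ 2 <= 2 * ln ((x + y) / 2) - ln x - ln y.
Proof.
move=> x0 y0; have xy0 : 0 < x + y by rewrite addr_gt0.
have h0 : 0 < (x + y) / 2 by rewrite divr_gt0.
set a := x * y / ((x + y) / 2) ^+ 2.
have a0 : 0 < a by rewrite divr_gt0 ?exprn_gt0// mulr_gt0.
have E : ln a = ln x + ln y - 2 * ln ((x + y) / 2).
  rewrite /a ln_div ?posrE ?exprn_gt0 ?mulr_gt0// lnM ?posrE// lnXn//.
  by rewrite mulr2n; ring.
have := le_ln1Dx (_ : -1 < a - 1); rewrite (_ : 1 + (a - 1) = a); last by ring.
have -> : ((x - y) / (x + y)) ^+ 2 = 1 - a.
  by rewrite /a; field; rewrite gt_eqF.
by move=> /(_ ltac:(lra)); lra.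
Qed.

Lemma ln_ratio_bound x y : 0 < x -> 0 < y -> `|x - y| / (x + y) <= 2^-1 ->
  `|ln x - ln y| <= 4 * (`|x - y| / (x + y)).
Proof.
wlog xy : x y / y <= x.
  move=> H x0 y0; have [xy|/ltW xy] := leP y x; first exact: (H x y).
  by rewrite (distrC x) (addrC x) (distrC (ln x)); exact: (H y x).
move=> x0 y0; have xy0 : 0 < x + y by rewrite addr_gt0.
rewrite !ger0_norm ?subr_ge0 ?ler_ln ?posrE// => h.
have h' : x <= 3 * y by move: h; rewrite ler_pdivrMr//; lra.
rewrite -ln_div ?posrE//.
have := le_ln1Dx (_ : -1 < x / y - 1).
rewrite (_ : 1 + (x / y - 1) = x / y); last by ring.
have xy1 : 0 < x / y by rewrite divr_gt0.
move=> /(_ ltac:(lra)) /le_trans; apply.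
rewrite (_ : x / y - 1 = (x - y) / y); last by field; rewrite gt_eqF.
by rewrite mulrA ler_pdivrMr// mulrAC ler_pdivlMr//; nra.
Qed.

(** The relative increments control the increments of the logarithm once they
    are at most 1/2, so their summability keeps the limit away from 0 and
    from infinity. *)
Lemma cvg_ln_of_summable (x : R^nat) : (forall n, 0 < x n) ->
  cvgn (series (fun n => `|x n - x n.+1| / (x n + x n.+1))) ->
  cvgn (fun n => ln (x n)).
Proof.
move=> x0 cv; pose v n : R := `|x n - x n.+1| / (x n + x n.+1).
have v0 n : 0 <= v n by rewrite divr_ge0// ltW// addr_gt0.
have [N _ hN] : \forall n \near \oo, v n <= 2^-1.
  have := cvg_series_cvg_0 cv => /cvgrPdist_le/(_ 2^-1)[|N _ H]; first by [].
  by exists N => // n /H; rewrite /= sub0r normrN ger0_norm//; exact: v0.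
pose u n := ln (x (n + N)%N).
suff /cvg_ex[l ul] : cvgn u.
  by apply/cvg_ex; exists l; rewrite -(cvg_shiftn N); exact: ul.
have <- : series (telescope u) \+ cst (u 0%N) = u.
  by apply/funext => n /=; rewrite telescopeK /= subrK.
apply: is_cvgD; last exact: is_cvg_cst.
apply: normed_cvg.
have : cvgn (series (fun n => v (n + N)%N)).
  have /cvg_ex[l vl] : cvgn [sequence \sum_(N <= k < n) v k]_n.
    by rewrite is_cvg_series_restrict.
  apply/cvg_ex; exists l; move: vl; rewrite -(cvg_shiftn N).
  rewrite (_ : [sequence _]_n = series (fun n => v (n + N)%N))//.
  by apply/funext => n; rewrite /series /= -{1}(add0n N) big_addn addnK.
move=> cv'; have := @is_cvg_seriesZ _ _ (4 : R) cv'; apply: series_le_cvg.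
- by move=> n; exact: normr_ge0.
- by move=> n; rewrite /= mulr_ge0// v0.
- move=> n; rewrite /telescope /u /= addSn distrC.
  by apply: ln_ratio_bound => //; apply: hN => /=; rewrite leq_addl.
Qed.

End real_inequalities.

(** * Measurability and integration lemmas *)

Section measurability.
Local Open Scope ereal_scope.
Context d (T : measurableType d) (R : realType).

Lemma measurable_fun_lne (f : T -> \bar R) :
  measurable_fun setT f -> measurable_fun setT (fun w => lne (f w)).
Proof.
move=> mf; rewrite (_ : (fun _ => _) =
  (fun w => if 0 < f w then er_map (@ln R) (f w) else -oo)).
  apply: measurable_fun_ifT => //.
  - exact: measurable_fun_lte.
  - have mln : measurable_fun setT (er_map (@ln R)).
      exact: (@measurable_er_map _ (measurableTypeR R) R _ (@measurable_ln R)).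
    exact: measurableT_comp mln mf.
apply/funext => w; case: (f w) => [r| |] //=; last by rewrite lt0y.
by rewrite lte_fin; case: ltP.
Qed.

Lemma measurable_fun_inv_ge0 (f : T -> R) : measurable_fun setT f ->
  (forall w, 0 <= f w)%R -> measurable_fun setT (fun w => (f w)^-1)%R.
Proof.
move=> mf f0; rewrite (_ : (fun _ => _) = (fun w => f w `^ (-1)))%R.
  exact: (measurableT_comp (measurable_powR (-1)%R) mf).
by apply/funext => w; rewrite powR_inv1.
Qed.

End measurability.

Section bounded_integrals.
Context d (T : measurableType d) (R : realType).
Implicit Types (f : T -> R) (Q : probability T R).

Lemma finite_measure_bounded_integrable (mu : {finite_measure set T -> \bar R}) f M :
  measurable_fun setT f -> (forall w, `|f w| <= M) -> mu.-integrable setT (EFin \o f).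
Proof.
move=> mf fM; apply: measurable_bounded_integrable => //.
  by rewrite ltey_eq fin_num_measure.
by exists M; split; [exact: num_real|] => x Mx w _; rewrite /= (le_trans (fM w))// ltW.
Qed.

Lemma Rintegral_mixture Q Q1 Q2 (t : R) f M : 0 <= t <= 1 ->
  (forall A, measurable A -> (Q A = t%:E * Q1 A + (1 - t)%:E * Q2 A)%E) ->
  measurable_fun setT f -> (forall w, `|f w| <= M) ->
  \int[Q]_w f w = t * \int[Q1]_w f w + (1 - t) * \int[Q2]_w f w.
Proof.
move=> /andP[t0 t1] QE mf fM.
have t1' : 0 <= 1 - t by rewrite subr_ge0.
have mixE (g : T -> \bar R) : measurable_fun setT g -> (forall w, 0 <= g w)%E ->
    (\int[Q]_w g w = t%:E * \int[Q1]_w g w + (1 - t)%:E * \int[Q2]_w g w)%E.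
  move=> mg g0.
  rewrite (@eq_measure_integral _ _ _ setT
    (measure_add (mscale (NngNum t0) Q1) (mscale (NngNum t1') Q2))).
    by rewrite ge0_integral_measure_add// !ge0_integral_mscale.
  move=> A mA _; apply: (etrans (QE A mA)).
  by rewrite /measure_add/= /msum 2!big_ord_recl/= big_ord0 adde0.
have M0 w : 0 <= f w + M by have := fM w; rewrite ler_norml => /andP[]; lra.
have int (P : probability T R) : P.-integrable setT (EFin \o f).
  exact: (@finite_measure_bounded_integrable P f M).
have intE (P : probability T R) : (\int[P]_w (f w + M)%:E)%E = (\int[P]_w f w + M)%:E.
  rewrite integralD_EFin//; [|exact: int|exact: finite_measure_integrable_cst].
  rewrite integral_cst//= probability_setT mule1 EFinD fineK//.
  exact: (integrable_fin_num measurableT (int P)).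
have mfM : measurable_fun setT (fun w => (f w + M)%:E).
  by apply/measurable_EFinP; exact: measurable_funD.
have := mixE _ mfM M0; rewrite !intE -!EFinM -EFinD => /(congr1 fine)/= e; lra.
Qed.

(** The negative part of a nonnegative measure vanishes whichever Hahn
    decomposition is used, since the measure of [N] is at most 0. *)
Lemma jordan_integral_probability Q f P N
    (PN : hahn_decomposition (charge_of_finite_measure Q) P N) :
  \int[jordan_pos PN]_w f w - \int[jordan_neg PN]_w f w = \int[Q]_w f w.
Proof.
have [[mP posP] [mN negN] PNT PN0] := PN.
have QN A : measurable A -> Q (A `&` N) = 0%E.
  move=> mA; apply/eqP; rewrite eq_le measure_ge0 andbT.
  by apply: negN; [exact: measurableI|exact: subIsetr].
have posE A : measurable A -> jordan_pos PN A = Q A.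
  move=> mA; rewrite jordan_posE cjordan_posE /crestr0 mem_set// /crestr/=.
  have := setIT A; rewrite -PNT setIUr => {2}<-; rewrite measureU//.
  - by rewrite [X in (_ + X)%E]QN// adde0.
  - exact: measurableI.
  - exact: measurableI.
  - by rewrite setIACA PN0 setI0.
have negE A : measurable A -> jordan_neg PN A = 0%E.
  move=> mA; rewrite jordan_negE cjordan_negE /crestr0 mem_set// /crestr/=.
  by rewrite QN// oppe0.
rewrite /Rintegral (@eq_measure_integral _ _ _ _ Q); last by move=> A mA _; exact: posE.
rewrite [X in _ - fine X](_ : _ = 0%E) ?subr0//.
rewrite (@eq_measure_integral _ _ _ _ mzero) ?integral_measure_zero//.
by move=> A mA _; exact: negE.
Qed.

Lemma charge_integral_probability Q f :
  charge_integral (charge_of_finite_measure Q) f = \int[Q]_w f w.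
Proof. exact: jordan_integral_probability. Qed.

End bounded_integrals.

Section fatou.
Local Open Scope ereal_scope.
Context d (T : measurableType d) (R : realType) (mu : {measure set T -> \bar R}).

Lemma cvgn_EFin (u : nat -> R) (l : R) :
  u n @[n --> \oo] --> l -> (u n)%:E @[n --> \oo] --> l%:E.
Proof. by move=> ul; apply: cvg_EFin => //; exact: nearW. Qed.

Lemma fatou_ae (h : nat -> T -> R) (f : T -> R) (c : nat -> R) (l : R) :
  (forall n, measurable_fun setT (h n)) -> (forall n w, 0 <= h n w)%R ->
  measurable_fun setT f -> (forall w, 0 <= f w)%R ->
  {ae mu, forall w, h n w @[n --> \oo] --> f w} ->
  (forall n, \int[mu]_w (h n w)%:E <= (c n)%:E) -> c n @[n --> \oo] --> l ->
  \int[mu]_w (f w)%:E <= l%:E.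
Proof.
move=> mh h0 mf f0 hf hc cl.
have mhE n : measurable_fun setT (fun w => (h n w)%:E) by exact/measurable_EFinP.
have -> : \int[mu]_w (f w)%:E = \int[mu]_w limn_einf (fun n => (h n w)%:E).
  apply: ae_eq_integral => //; first exact/measurable_EFinP.
  - rewrite /limn_einf; apply: measurableT_comp => //.
    by apply: measurable_fun_limn_esup => n; exact: measurableT_comp.
  - apply: filterS hf => w hw _.
    by have [-> _] := @cvg_limn_einf_sup R _ _ (cvgn_EFin hw).
apply: le_trans (fatou mu measurableT mhE _) _ => [n w _|]; first by rewrite lee_fin.
rewrite limn_einf_lim -(cvg_lim _ (cvgn_EFin cl))//; apply: lee_lim.
- exact: is_cvg_einfs.
- by apply/cvg_ex; exists l%:E; exact: cvgn_EFin.
- by apply: nearW => n; apply: le_trans (hc n); apply: ereal_inf_lbound; exists n => //=.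
Qed.

End fatou.

Section summable.
Context d (T : measurableType d) (R : realType) (mu : {measure set T -> \bar R}).

(** The sum of the series has integral at most [c], so it is finite almost
    everywhere. *)
Lemma ae_cvg_series (v : nat -> T -> R) (c : R) : (forall n, measurable_fun setT (v n)) ->
  (forall n w, 0 <= v n w) -> 0 <= c ->
  (forall n, (\int[mu]_w (v n w)%:E <= (c / (2 ^ n.+1)%:R)%:E)%E) ->
  {ae mu, forall w, cvgn (series (fun n => v n w))}.
Proof.
move=> mv v0 c0 vc.
have mvE n : measurable_fun setT (fun w => (v n w)%:E) by exact/measurable_EFinP.
pose V w := (\sum_(n <oo) (v n w)%:E)%E.
have V0 w : (0 <= V w)%E by apply: nneseries_ge0 => n _ _; rewrite lee_fin.
have intV : mu.-integrable setT V.
  apply/integrableP; split.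
    by apply: ge0_emeasurable_sum => // n w _; rewrite lee_fin.
  under eq_integral do rewrite gee0_abs//.
  rewrite /V integral_nneseries//; last by move=> n w _; rewrite lee_fin.
  apply: le_lt_trans (ltry c); apply: le_trans (epsilon_trick0 xpredT c0).
  apply: lee_nneseries => [n _ _|n _]; last exact: vc.
  by apply: integral_ge0 => w _; rewrite lee_fin.
have := integrable_ae measurableT intV; apply: filterS => w /(_ I) Vw.
apply: nondecreasing_is_cvgn; first exact: nondecreasing_series.
exists (fine (V w)) => _ [n _ <-].
rewrite -lee_fin fineK// -sumEFin.
by apply: nneseries_lim_ge => k _ _; rewrite lee_fin.
Qed.

End summable.

Section le_integral.
Local Open Scope ereal_scope.
Context d (T : measurableType d) (R : realType) (mu : {measure set T -> \bar R}).

(** Positive parts increase and negative parts decrease, so the comparison holds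
    even when an integral has the form infinity minus infinity. *)
Lemma measurable_le_integral (a b : T -> \bar R) : measurable_fun setT a ->
  measurable_fun setT b -> (forall w, a w <= b w) -> \int[mu]_w a w <= \int[mu]_w b w.
Proof.
move=> ma mb ab; rewrite integralE [leRHS]integralE; apply: leeB.
  apply: ge0_le_integral => //; [exact: measurable_funepos|exact: measurable_funepos|].
  by move=> w _; rewrite !funeposE ge_max !le_max ab lexx orbT.
apply: ge0_le_integral => //; [exact: measurable_funeneg|exact: measurable_funeneg|].
by move=> w _; rewrite !funenegE ge_max !le_max leeN2 ab lexx orbT.
Qed.

End le_integral.

(** * E-variables bounded and bounded away from 0 *)

Section tame.
Context d (T : measurableType d) (R : realType).
Implicit Types (X : T -> R) (Q : probability T R) (PP QQ : set (probability T R)).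

(** Two-sided bounds make [ln X] a bounded function, so that its integral is a
    real number which is continuous in the setwise topology. *)
Definition tame_e_variables PP : set (T -> R) :=
  [set X : T -> R | [/\ measurable_fun setT X,
     exists2 e, 0 < e & exists M, forall w, e <= X w <= M &
     forall P, PP P -> (\int[P]_w (X w)%:E <= 1)%E]].

Definition log_growth Q X : R := \int[Q]_w ln (X w).

Lemma tame_gt0 PP X w : tame_e_variables PP X -> 0 < X w.
Proof. by move=> [_ [e e0 [M /(_ w)/andP[eX _]]] _]; exact: lt_le_trans eX. Qed.

Lemma tame_measurable PP X : tame_e_variables PP X -> measurable_fun setT X.
Proof. by case. Qed.

Lemma tame_measurable_ln PP X : tame_e_variables PP X ->
  measurable_fun setT (fun w => ln (X w)).
Proof. by move=> [mX _ _]; apply: measurableT_comp => //; exact: measurable_ln. Qed.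

Lemma tame_ln_bounded PP X : tame_e_variables PP X ->
  exists M, forall w, `|ln (X w)| <= M.
Proof.
move=> [_ [e e0 [M eXM]] _]; exists (Num.max (- ln e) (ln M)) => w.
have /andP[eX XM] := eXM w; have X0 : 0 < X w by exact: lt_le_trans eX.
have M0 : 0 < M by exact: lt_le_trans XM.
rewrite ler_norml lerNl !le_max lerN2 !ler_ln ?posrE// eX XM/=.
by rewrite orbT.
Qed.

Lemma tame_integrable_ln PP X Q : tame_e_variables PP X ->
  Q.-integrable setT (EFin \o (fun w => ln (X w))).
Proof.
move=> tX; have [M hM] := tame_ln_bounded tX.
exact: (finite_measure_bounded_integrable Q (tame_measurable_ln tX) hM).
Qed.

Lemma tame1 PP : tame_e_variables PP (cst 1).
Proof.
split => //; first by exists 1 => //; exists 1 => w; rewrite lexx.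
by move=> P _; rewrite (eq_integral (cst 1%E))// integral_cst//= probability_setT mule1.
Qed.

Lemma log_growth1 Q : log_growth Q (cst 1) = 0.
Proof.
rewrite /log_growth (@eq_Rintegral _ _ _ _ _ (cst 0)); last by move=> w _; rewrite /= ln1.
by rewrite Rintegral_cst// mul0r.
Qed.

Lemma tame_mix PP X1 X2 (t : R) : tame_e_variables PP X1 -> tame_e_variables PP X2 ->
  0 <= t <= 1 -> tame_e_variables PP (fun w => t * X1 w + (1 - t) * X2 w).
Proof.
move=> t1 t2 /andP[t0 t1'].
have [mX1 [e1 e10 [M1 eM1]] E1] := t1; have [mX2 [e2 e20 [M2 eM2]] E2] := t2.
have s0 : 0 <= 1 - t by rewrite subr_ge0.
split.
- by apply: measurable_funD; apply: measurable_funM.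
- exists (Num.min e1 e2); first by rewrite lt_min e10.
  exists (Num.max M1 M2) => w; have /andP[? ?] := eM1 w; have /andP[? ?] := eM2 w.
  set m := Num.min _ _; set M := Num.max _ _.
  have [? ?] : m <= e1 /\ m <= e2 by rewrite !ge_min !lexx orbT.
  have [? ?] : M1 <= M /\ M2 <= M by rewrite !le_max !lexx orbT.
  by apply/andP; split; nra.
- move=> P PPP; have p1 w := ltW (tame_gt0 w t1); have p2 w := ltW (tame_gt0 w t2).
  under eq_integral do rewrite EFinD !EFinM.
  rewrite ge0_integralD//; last 4 first.
  + by move=> w _; rewrite -EFinM lee_fin mulr_ge0.
  + by apply/measurable_EFinP; apply: measurable_funM.
  + by move=> w _; rewrite -EFinM lee_fin mulr_ge0.
  + by apply/measurable_EFinP; apply: measurable_funM.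
  rewrite !ge0_integralZl//; last 4 first.
  + exact/measurable_EFinP.
  + by move=> w _; rewrite lee_fin.
  + exact/measurable_EFinP.
  + by move=> w _; rewrite lee_fin.
  rewrite (_ : 1%E = (t%:E * 1 + (1 - t)%:E * 1)%E); last first.
    by rewrite !mule1 -EFinD addrC subrK.
  by rewrite leeD// lee_wpmul2l ?lee_fin// ?E1 ?E2.
Qed.

Lemma ln_concave (x y t : R) : 0 < x -> 0 < y -> 0 <= t <= 1 ->
  t * ln x + (1 - t) * ln y <= ln (t * x + (1 - t) * y).
Proof.
move=> x0 y0 t01; have := @concave_ln R (@Itv01 R t _ _) x y x0 y0.
by case/andP: t01 => t0 t1; move=> /(_ t0 t1); rewrite !convRE.
Qed.

Lemma log_growth_concave PP X1 X2 Q (t : R) : tame_e_variables PP X1 ->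
  tame_e_variables PP X2 -> 0 <= t <= 1 ->
  t * log_growth Q X1 + (1 - t) * log_growth Q X2 <=
  log_growth Q (fun w => t * X1 w + (1 - t) * X2 w).
Proof.
move=> t1 t2 t01; have t3 := tame_mix t1 t2 t01.
have i1 := tame_integrable_ln Q t1; have i2 := tame_integrable_ln Q t2.
have i3 := tame_integrable_ln Q t3.
have j1 : Q.-integrable setT (EFin \o (fun w => t * ln (X1 w))).
  exact: (@integrableZl _ _ _ Q _ measurableT t _ i1).
have j2 : Q.-integrable setT (EFin \o (fun w => (1 - t) * ln (X2 w))).
  exact: (@integrableZl _ _ _ Q _ measurableT (1 - t) _ i2).
rewrite /log_growth -!RintegralZl// -RintegralD//; apply: le_Rintegral => //.
  exact: (@integrableD _ _ _ Q _ measurableT _ _ j1 j2).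
by move=> w _; exact: ln_concave (tame_gt0 w t1) (tame_gt0 w t2) t01.
Qed.

Lemma open_log_growth PP X (c : R) : tame_e_variables PP X ->
  open [set nu : setwise T R | c < charge_integral nu (fun w => ln (X w))].
Proof.
move=> tX; have [M hM] := tame_ln_bounded tX.
have bX : bounded_fun (fun w => ln (X w)).
  by exists M; split; [exact: num_real|] => x Mx w _; rewrite /= (le_trans (hM w))// ltW.
pose f : bounded_measurable T R := exist _ _ (conj (tame_measurable_ln tX) bX).
rewrite openE /= => nu cnu; rewrite /interior.
have := @cvg_sup _ _ (fun g : bounded_measurable T R =>
    Topological.on (initial_topology (fun nu : signed_measure T R =>
      charge_integral nu (sval g)))) (nbhs (nu : setwise T R)) nu _.
move=> [/(_ (@cvg_id _ _)) /(_ f) H _].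
apply: H.
exists [set mu : signed_measure T R |
  c < charge_integral mu (fun w => ln (X w))]; split => //.
by exists [set x | c < x].
Qed.

End tame.

(** * Minimax over a setwise compact set *)

(** The covering characterization of compactness is stated for pointed spaces. *)
HB.instance Definition _ d (T : measurableType d) (R : realType) :=
  isPointed.Build (setwise T R) (charge_of_finite_measure (@mzero _ T R)).

Section minimax.
Context d (T : measurableType d) (R : realType).
Implicit Types (X : T -> R) (Q : probability T R) (PP QQ : set (probability T R)).

(** The value [c'] strictly above [c] comes from indexing the open cover by pairs
    of an e-variable and a level above [c]: the smallest of the finitely
    many levels is still above [c], while finite minimax only yields a weak
    inequality. *)
Lemma log_growth_minimax PP QQ (c : R) :
  convex_probabilities QQ -> setwise_compact QQ ->
  (forall Q, QQ Q -> exists2 X, tame_e_variables PP X & c < log_growth Q X) ->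
  exists2 c', c < c' &
  exists2 X, tame_e_variables PP X & forall Q, QQ Q -> c' <= log_growth Q X.
Proof.
move=> cvxQ; rewrite /setwise_compact compact_cover => cptQ supQ.
pose D := [set i : (T -> R) * R | tame_e_variables PP i.1 /\ c < i.2].
pose O (i : (T -> R) * R) : set (setwise T R) :=
  [set nu : setwise T R | i.2 < charge_integral nu (fun w => ln (i.1 w))].
have [|_ [Q QQQ <-]|D' D'D covD'] := cptQ _ D O.
- by move=> i [tX _]; exact: open_log_growth tX.
- have [X tX cX] := supQ Q QQQ.
  exists (X, (c + log_growth Q X) / 2); first by split => //=; lra.
  by rewrite /O /= charge_integral_probability -/(log_growth Q X); lra.
have [c' cc' c'le] : exists2 c', c < c' & forall i, i \in enum_fset D' -> c' <= i.2.
  have : {subset enum_fset D' <= D} by [].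
  elim: (enum_fset D') => [_|i s IH sD]; first by exists (c + 1) => //; lra.
  have [|c' cc' c'le] := IH; first by move=> j js; apply: sD; rewrite inE js orbT.
  have /set_mem[_ ci] : i \in D by apply: sD; rewrite inE eqxx.
  exists (Num.min c' i.2); first by rewrite lt_min cc'.
  by move=> j; rewrite inE ge_min => /orP[/eqP ->|/c'le ->//]; rewrite lexx orbT.
exists c' => //.
pose F := [set (fun Q => log_growth Q X) | X in tame_e_variables PP].
pose fs := [seq (fun Q => log_growth Q i.1) | i <- enum_fset D'].
have [|||||h [X tX <-] hc] := @finite_minimax R (probability T R) QQ F c' fs
  (fun Q => log_growth Q (cst 1)); last by exists X.
- by exists (cst 1) => //; exact: tame1.
- move=> Q1 Q2 t Q1Q Q2Q t01; have [Q QQQ QE] := cvxQ Q1 Q2 t Q1Q Q2Q t01.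
  exists Q => // _ [X tX <-]; have [M hM] := tame_ln_bounded tX.
  exact: (Rintegral_mixture t01 QE (tame_measurable_ln tX) hM).
- move=> _ _ t [X1 t1 <-] [X2 t2 <-] t01.
  exists (fun Q => log_growth Q (fun w => t * X1 w + (1 - t) * X2 w)).
    by exists (fun w => t * X1 w + (1 - t) * X2 w) => //; exact: tame_mix.
  by move=> Q _; exact: log_growth_concave t1 t2 t01.
- move=> _ /mapP[i iD' ->]; apply/mem_set; exists i.1 => //.
  by have /set_mem[] := D'D i iD'.
- move=> Q QQQ; have [|i /= iD' il] := covD' (charge_of_finite_measure Q).
    by exists Q.
  exists (fun Q => log_growth Q i.1); first by apply/mapP; exists i.
  move: il; rewrite /O /= charge_integral_probability => /ltW.
  by apply: le_trans; exact: c'le.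
Qed.

End minimax.

(** * Weak duality *)

Section weak_duality.
Local Open Scope ereal_scope.
Local Open Scope charge_scope.
Context d (T : measurableType d) (R : realType).
Implicit Types (PP : set (probability T R)) (Q : probability T R)
  (P : {finite_measure set T -> \bar R}) (X : T -> \bar R).

(** [ln x - ln f <= x / f - 1], with positive and negative parts moved to the
    side where they are added: all terms are then nonnegative, and the
    inequality can be integrated even when [x] takes the values 0 and
    infinity. *)
Lemma log_ratio_bound (x : \bar R) (f : R) : 0 <= x -> (0 < f)%R ->
  maxe (lne x) 0 + (Num.max (- ln f) 0)%R%:E + 1 <=
  maxe (- lne x) 0 + (Num.max (ln f) 0)%R%:E + x * (f^-1)%:E.
Proof.
move=> + f0; case: x => [r| |]// r0; last first.
  by rewrite gt0_mulye ?lte_fin ?invr_gt0//= maxNye add0e addey// leey.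
have [->|rn0] := eqVneq r 0%R.
  by rewrite /= lexx/= mul0e adde0 maxye addye// leey.
have rp : (0 < r)%R by rewrite lt_neqAle eq_sym rn0.
rewrite lne_EFin// -EFinN -EFinM.
have -> : maxe (ln r)%:E 0 = (Num.max (ln r) 0)%R%:E by rewrite EFin_max.
have -> : maxe (- ln r)%:E 0 = (Num.max (- ln r) 0)%R%:E by rewrite EFin_max.
rewrite -!EFinD lee_fin.
have := le_ln1Dx (_ : -1 < r / f - 1)%R.
rewrite (_ : 1 + (r / f - 1) = r / f)%R; last by ring.
have rf : (0 < r / f)%R by rewrite divr_gt0.
rewrite ln_div ?posrE// => /(_ ltac:(lra)).
by rewrite !maxEle; do 4 case: ifPn => ?; lra.
Qed.

(** The finiteness of the integral of [1 / F] controls the negative part of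
    [ln F], so that the right-hand side never has the form infinity minus
    infinity. *)
Lemma expected_log_le Q X (F : T -> R) :
  measurable_fun setT X -> (forall w, 0 <= X w) ->
  measurable_fun setT F -> (forall w, 0 <= F w)%R ->
  {ae Q, forall w, 0 < F w}%R -> \int[Q]_w ((F w)^-1)%:E < +oo ->
  \int[Q]_w (X w * ((F w)^-1)%:E) <= 1 ->
  expected_log Q X <= \int[Q]_w lne (F w)%:E.
Proof.
move=> mX X0 mF F0 aeF finF D1.
have mlX := measurable_fun_lne mX.
have mlF : measurable_fun setT (fun w => lne (F w)%:E).
  exact/measurable_fun_lne/measurable_EFinP.
have mFV : measurable_fun setT (fun w => ((F w)^-1)%:E).
  exact/measurable_EFinP/measurable_fun_inv_ge0.
rewrite /expected_log; set a := fun w => lne (X w); set b := fun w => lne (F w)%:E.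
case: ifPn => [_|An]; first exact: leNye.
rewrite [leRHS]integralE -/b.
have mD : measurable_fun setT (fun w => X w * ((F w)^-1)%:E) by exact: emeasurable_funM.
have Bn : \int[Q]_w b^\- w < +oo.
  apply: le_lt_trans finF; apply: ae_ge0_le_integral => //.
  - exact: measurable_funeneg.
  - by move=> w _; rewrite lee_fin invr_ge0.
  apply: filterS aeF => w Fw _.
  rewrite funenegE /b lne_EFin// ge_max -EFinN lee_fin -lnV ?posrE// lee_fin.
  by rewrite invr_ge0 F0 andbT ltW// ln_sublinear// invr_gt0.
have ma1 : measurable_fun setT a^\+ by exact: measurable_funepos.
have ma2 : measurable_fun setT a^\- by exact: measurable_funeneg.
have mb1 : measurable_fun setT b^\+ by exact: measurable_funepos.
have mb2 : measurable_fun setT b^\- by exact: measurable_funeneg.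
have m12 : measurable_fun setT (fun w => a^\+ w + b^\- w) by exact: emeasurable_funD.
have m21 : measurable_fun setT (fun w => a^\- w + b^\+ w) by exact: emeasurable_funD.
have D0 w : 0 <= X w * ((F w)^-1)%:E by rewrite mule_ge0// lee_fin invr_ge0.
have key : \int[Q]_w a^\+ w + \int[Q]_w b^\- w + 1 <=
    \int[Q]_w a^\- w + \int[Q]_w b^\+ w + \int[Q]_w (X w * ((F w)^-1)%:E).
  rewrite -[X in _ + X <= _](@probability_setT _ _ _ Q) -[X in _ + X <= _]mul1e.
  rewrite -(integral_cst Q measurableT 1%E).
  rewrite -!ge0_integralD//; [|by move=> w _; rewrite adde_ge0..].
  apply: ae_ge0_le_integral => //.
  - by move=> w _; rewrite !adde_ge0.
  - exact: emeasurable_funD.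
  - by move=> w _; rewrite !adde_ge0.
  - exact: emeasurable_funD.
  apply: filterS aeF => w Fw _.
  rewrite !funeposE !funenegE /b lne_EFin//.
  have := log_ratio_bound (X0 w) Fw.
  by rewrite !EFin_max EFinN.
have A'0 : 0 <= \int[Q]_w a^\- w by exact: integral_ge0.
have A0 : 0 <= \int[Q]_w a^\+ w by exact: integral_ge0.
have B'0 : 0 <= \int[Q]_w b^\- w by exact: integral_ge0.
have B0 : 0 <= \int[Q]_w b^\+ w by exact: integral_ge0.
have ID0 : 0 <= \int[Q]_w (X w * ((F w)^-1)%:E) by exact: integral_ge0.
move: An Bn key D1 A'0 A0 B'0 B0 ID0.
move: (\int[Q]_w a^\+ w) (\int[Q]_w a^\- w) (\int[Q]_w b^\+ w) (\int[Q]_w b^\- w)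
  (\int[Q]_w (X w * _)) => [p| |] [q| |] [r| |] [s| |] [t| |] //= _ _.
  by rewrite -!EFinD !lee_fin => *; lra.
by move=> *; exact: leey.
Qed.

(** With [F] the density of [Q] in [P], the [Q]-integral of [X / F] is the
    [P]-integral of [X] over the set where [F] is positive. The nonnegative
    version [f] of the density is used in place of the derivative in the
    definition of the entropy; they agree [Q]-almost everywhere. *)
Lemma weak_duality PP Q P X : e_variables PP X -> effective_null PP P ->
  expected_log Q X <= relative_entropy Q P.
Proof.
move=> eX effP; have [mX X0 _] := eX.
rewrite /relative_entropy; case: asboolP => [QP|_]; last exact: leey.
pose f := Radon_Nikodym_SigmaFinite.f Q P.
have f0 w : 0 <= f w by exact: Radon_Nikodym_SigmaFinite.f_ge0.
have ff w : f w \is a fin_num by exact: Radon_Nikodym_SigmaFinite.f_fin_num.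
have mf : measurable_fun setT f.
  exact: measurable_int (Radon_Nikodym_SigmaFinite.f_integrable QP).
pose F w := fine (f w).
have F0 w : (0 <= F w)%R by exact: fine_ge0.
have FE w : (F w)%:E = f w by rewrite fineK.
have mF : measurable_fun setT F.
  by apply/measurable_EFinP; rewrite (_ : EFin \o F = f)//; apply/funext => w; exact: FE.
have fE : ae_eq Q setT f ('d (charge_of_finite_measure Q) '/d P).
  apply: (null_dominates_ae_eq measurableT QP).
  exact: ae_eq_Radon_Nikodym_SigmaFinite.
have -> : \int[Q]_w lne (('d (charge_of_finite_measure Q) '/d P) w) =
    \int[Q]_w lne (F w)%:E.
  apply: ae_eq_integral => //.
  - exact: measurable_fun_lne.
  - exact/measurable_fun_lne/measurable_EFinP.
  - by apply: filterS fE => w fw _; rewrite FE fw.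
have aeF : {ae Q, forall w, 0 < F w}%R.
  have mf0 : measurable [set w | f w = 0].
    by rewrite -[X in measurable X]setTI; exact: (mf measurableT [set 0]).
  exists [set w | f w = 0]; split => //.
    rewrite (Radon_Nikodym_SigmaFinite.f_integral QP mf0) -/f.
    by rewrite (eq_integral (cst 0)) ?integral0// => w /set_mem.
  move=> w /= /negP; rewrite -leNgt => Fw; rewrite -FE; congr EFin.
  by apply/eqP; rewrite eq_le Fw F0.
have intD Y : measurable_fun setT Y -> (forall w, 0 <= Y w) ->
    \int[Q]_w (Y w * ((F w)^-1)%:E) <= \int[P]_w Y w.
  move=> mY Y0.
  have mYF : measurable_fun setT (fun w => Y w * ((F w)^-1)%:E).
    by apply: emeasurable_funM => //; exact/measurable_EFinP/measurable_fun_inv_ge0.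
  have YF0 w : 0 <= Y w * ((F w)^-1)%:E by rewrite mule_ge0// lee_fin invr_ge0.
  rewrite -(Radon_Nikodym_SigmaFinite.change_of_variables QP)// -/f.
  apply: ge0_le_integral => //.
  - by move=> w _; rewrite mule_ge0.
  - exact: emeasurable_funM.
  - move=> w _; rewrite -FE -muleA -EFinM.
    have [->|Fw] := eqVneq (F w) 0%R; first by rewrite mulr0 mule0.
    by rewrite mulVf// mule1.
apply: expected_log_le => //.
- rewrite (_ : \int[Q]_w _ = \int[Q]_w (cst 1 w * ((F w)^-1)%:E)).
    apply: le_lt_trans (intD _ _ _) _ => //.
    by rewrite integral_cst// mul1e ltey_eq fin_num_measure.
  by apply: eq_integral => w _; rewrite mul1e.
- by apply: le_trans (intD _ _ _) _ => //; exact: effP.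
Qed.

End weak_duality.

(** * Measures with a density *)

Definition density_measure d (T : measurableType d) (R : realType)
  (mu : {measure set T -> \bar R}) (Y : T -> R) (A : set T) : \bar R :=
  (\int[mu]_(w in A) (Y w)%:E)%E.

Section density.
Local Open Scope ereal_scope.
Context d (T : measurableType d) (R : realType).
Variables (mu : {finite_measure set T -> \bar R}) (Y : T -> R).
Hypotheses (mY : measurable_fun setT Y) (Y0 : forall w, (0 <= Y w)%R)
  (intY : \int[mu]_w (Y w)%:E < +oo).

Let nu := density_measure mu Y.

Let nu0 : nu set0 = 0. Proof. exact: integral_set0. Qed.

Let nu_ge0 A : 0 <= nu A.
Proof. by apply: integral_ge0 => w _; rewrite lee_fin. Qed.

Let nu_sigma_additive : semi_sigma_additive nu.
Proof.
apply: semi_sigma_additive_nng_induced => [|w]; last by rewrite lee_fin.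
exact/measurable_EFinP.
Qed.

Let nu_measure : {measure set T -> \bar R} :=
  HB.pack nu (isMeasure.Build _ _ _ nu nu0 nu_ge0 nu_sigma_additive).

Let nu_fin : fin_num_fun nu.
Proof.
move=> A mA; rewrite ge0_fin_numE//; apply: le_lt_trans intY.
apply: ge0_subset_integral => //; first exact/measurable_EFinP.
by move=> w _; rewrite lee_fin.
Qed.

Definition finite_density_measure : {finite_measure set T -> \bar R} :=
  HB.pack nu (isMeasure.Build _ _ _ nu nu0 nu_ge0 nu_sigma_additive)
    (Measure_isFinite.Build _ _ _ nu_measure nu_fin).

Lemma density_measureE A : finite_density_measure A = \int[mu]_(w in A) (Y w)%:E.
Proof. by []. Qed.

Lemma density_dominated : finite_density_measure `<< mu.
Proof.
apply/null_content_dominatesP => A mA A0; rewrite density_measureE.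
apply: null_set_integral => //.
by apply/measurable_funTS/measurable_EFinP.
Qed.

Lemma integral_density A (f : T -> \bar R) : measurable A ->
  measurable_fun setT f -> (forall w, 0 <= f w) ->
  \int[finite_density_measure]_(w in A) f w = \int[mu]_(w in A) (f w * (Y w)%:E).
Proof.
move=> mA mf f0.
rewrite -(Radon_Nikodym_SigmaFinite.change_of_variables density_dominated)//;
  last exact: measurable_funTS.
have mRN := measurable_int _ (Radon_Nikodym_SigmaFinite.f_integrable density_dominated).
have mYE : measurable_fun setT (EFin \o Y) by exact/measurable_EFinP.
have RNE : ae_eq mu setT
    (Radon_Nikodym_SigmaFinite.f finite_density_measure mu) (EFin \o Y).
  apply: integral_ae_eq => //.
    exact: Radon_Nikodym_SigmaFinite.f_integrable density_dominated.
  move=> E _ mE; rewrite -Radon_Nikodym_SigmaFinite.f_integral//.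
  exact: density_dominated.
apply: ae_eq_integral => //.
- by apply: measurable_funTS; exact: emeasurable_funM.
- by apply: measurable_funTS; exact: emeasurable_funM.
- by apply: filterS RNE => w /= E _; rewrite E.
Qed.

End density.

(** * Nearly optimal e-variables *)

Section optimality.
Context d (T : measurableType d) (R : realType).
Variables (PP : set (probability T R)) (Q : probability T R) (g : R).
Hypothesis ub : forall X, tame_e_variables PP X -> log_growth Q X <= g.
Implicit Types (X : T -> R).

Lemma integral_le_Rintegral (h f : T -> R) (c : R) : measurable_fun setT h ->
  (forall w, 0 <= h w) -> (forall w, h w <= f w) -> Q.-integrable setT (EFin \o f) ->
  \int[Q]_w f w <= c -> (\int[Q]_w (h w)%:E <= c%:E)%E.
Proof.
move=> mh h0 hf intf fc; apply: (@le_trans _ _ (\int[Q]_w f w)%:E); last by rewrite lee_fin.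
rewrite fineK; last exact: integrable_fin_num intf.
apply: ge0_le_integral => //.
- by move=> w _; rewrite lee_fin.
- exact/measurable_EFinP.
- exact: measurable_int intf.
- by move=> w _; rewrite lee_fin.
Qed.

(** [(X1 + r X2) / (1 + r)] is again a tame e-variable, hence subject to [ub]. *)
Lemma log_sum_bound X1 X2 (r : R) :
  tame_e_variables PP X1 -> tame_e_variables PP X2 -> 0 < r ->
  Q.-integrable setT (EFin \o (fun w => ln (X1 w + r * X2 w))) /\
  \int[Q]_w ln (X1 w + r * X2 w) <= g + r.
Proof.
move=> t1 t2 r0; pose t := (1 + r)^-1.
have r1 : 0 < 1 + r by lra.
have t01 : 0 <= t <= 1 by rewrite invr_ge0 ltW//= invf_le1//; lra.
have t12 := tame_mix t1 t2 t01.
have E w : ln (X1 w + r * X2 w) = ln (t * X1 w + (1 - t) * X2 w) + ln (1 + r).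
  rewrite -lnM ?posrE//; last exact: tame_gt0 t12.
  by congr ln; rewrite /t; field; rewrite gt_eqF.
have int12 := tame_integrable_ln Q t12.
have intc : Q.-integrable setT (EFin \o cst (ln (1 + r))).
  exact: finite_measure_integrable_cst.
split.
  rewrite (_ : _ \o _ = (EFin \o (fun w => ln (t * X1 w + (1 - t) * X2 w))) \+
    (EFin \o cst (ln (1 + r))))%E.
    exact: integrableD.
  by apply/funext => w /=; rewrite E.
under eq_Rintegral do rewrite E.
rewrite RintegralD// Rintegral_cst//= probability_setT/= mulr1 lerD//.
  exact: ub t12.
by apply: le_ln1Dx; lra.
Qed.

(** First-order optimality: the integrand is the derivative of [ln (X1 + r X2)]
    in [r], so by concavity it is at most the increment of this function between
    0 and [r], divided by [r]; the increment is controlled by [log_sum_bound] and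
    by the defect [dl] of [X1]. *)
Lemma near_optimal_ratio X1 X2 (r dl : R) :
  tame_e_variables PP X1 -> tame_e_variables PP X2 ->
  0 < r -> g - dl <= log_growth Q X1 ->
  (\int[Q]_w (X2 w / (X1 w + r * X2 w))%:E <= (1 + dl / r)%:E)%E.
Proof.
move=> t1 t2 r0 opt; have [intS leS] := log_sum_bound t1 t2 r0.
have p1 w := tame_gt0 w t1; have p2 w := tame_gt0 w t2.
have pS w : 0 < X1 w + r * X2 w by rewrite addr_gt0// mulr_gt0.
have int1 := tame_integrable_ln Q t1.
have intB : Q.-integrable setT (EFin \o (fun w => ln (X1 w + r * X2 w) - ln (X1 w))).
  exact: (@integrableB _ _ _ Q _ measurableT _ _ intS int1).
apply: (@integral_le_Rintegral _ (fun w => r^-1 * (ln (X1 w + r * X2 w) - ln (X1 w)))).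
- apply: measurable_funM; first exact: tame_measurable t2.
  apply: measurable_fun_inv_ge0 => [|w]; last exact: ltW.
  apply: measurable_funD; first exact: tame_measurable t1.
  by apply: measurable_funM => //; exact: tame_measurable t2.
- by move=> w; rewrite divr_ge0// ltW.
- move=> w; rewrite [leRHS]mulrC ler_pdivlMr// -ln_div ?posrE//.
  rewrite -lerN2 -lnV ?posrE ?divr_gt0// invf_div.
  set u := X1 w / _; have u0 : 0 < u by rewrite divr_gt0.
  have := le_ln1Dx (_ : -1 < u - 1); rewrite (_ : 1 + (u - 1) = u); last by ring.
  move=> /(_ ltac:(lra)) /le_trans; apply.
  rewrite le_eqVlt; apply/orP; left; apply/eqP.
  by rewrite /u; field; rewrite gt_eqF.
- exact: (@integrableZl _ _ _ Q _ measurableT r^-1 _ intB).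
- rewrite RintegralZl// RintegralB// mulrC ler_pdivrMr// mulrDl mul1r divfK ?gt_eqF//.
  by move: opt leS; rewrite /log_growth; lra.
Qed.

(** Two nearly optimal e-variables are close, since otherwise their midpoint
    would exceed the bound [g]. The parameter [c] replaces the Cauchy-Schwarz
    inequality in the passage from the square of the relative distance, which
    concavity controls, to the distance itself. *)
Lemma near_optimal_distance X1 X2 (dl c : R) :
  tame_e_variables PP X1 -> tame_e_variables PP X2 ->
  0 < c -> g - dl <= log_growth Q X1 -> g - dl <= log_growth Q X2 ->
  (\int[Q]_w (`|X1 w - X2 w| / (X1 w + X2 w))%:E <= (c * dl + c^-1 / 2)%:E)%E.
Proof.
move=> t1 t2 c0 opt1 opt2.
have p1 w := tame_gt0 w t1; have p2 w := tame_gt0 w t2.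
have pS w : 0 < X1 w + X2 w by rewrite addr_gt0.
have h01 : 0 <= (2^-1 : R) <= 1 by apply/andP; split; lra.
have t3 := tame_mix t1 t2 h01; set X3 := (fun w => _) in t3.
have opt3 := ub t3.
have int1 := tame_integrable_ln Q t1; have int2 := tame_integrable_ln Q t2.
have int3 := tame_integrable_ln Q t3.
have int3' := @integrableZl _ _ _ Q _ measurableT 2 _ int3.
have intB := @integrableB _ _ _ Q _ measurableT _ _ int3' int1.
have intBB := @integrableB _ _ _ Q _ measurableT _ _ intB int2.
have intc : Q.-integrable setT (EFin \o cst (c^-1 / 2)).
  exact: finite_measure_integrable_cst.
have intZ := @integrableZl _ _ _ Q _ measurableT (c / 2) _ intBB.
apply: (@integral_le_Rintegral _ (fun w =>
  c / 2 * (2 * ln (X3 w) - ln (X1 w) - ln (X2 w)) + c^-1 / 2)).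
- apply: measurable_funM.
    apply: measurableT_comp => //.
    by apply: measurable_funB; [exact: tame_measurable t1|exact: tame_measurable t2].
  apply: measurable_fun_inv_ge0 => [|w]; last exact: ltW.
  by apply: measurable_funD; [exact: tame_measurable t1|exact: tame_measurable t2].
- by move=> w; rewrite divr_ge0// ltW.
- move=> w; have := ln_midpoint (p1 w) (p2 w).
  have -> : (X1 w + X2 w) / 2 = X3 w by rewrite /X3; field.
  set u := (X1 w - X2 w) / (X1 w + X2 w); set W := _ - _ - _ => uW.
  have -> : `|X1 w - X2 w| / (X1 w + X2 w) = `|u|.
    by rewrite normrM normfV (gtr0_norm (pS w)).
  have : c^-1 * (c * `|u| - 1) ^+ 2 / 2 = c / 2 * u ^+ 2 - `|u| + c^-1 / 2.
    by rewrite -[u ^+ 2]real_normK ?num_real//; field; rewrite gt_eqF.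
  have : 0 <= c^-1 * (c * `|u| - 1) ^+ 2 / 2.
    by rewrite divr_ge0// mulr_ge0 ?sqr_ge0// invr_ge0 ltW.
  have : c / 2 * u ^+ 2 <= c / 2 * W by rewrite ler_wpM2l// divr_ge0// ltW.
  by lra.
- exact: (@integrableD _ _ _ Q _ measurableT _ _ intZ intc).
- rewrite RintegralD// Rintegral_cst//= probability_setT/= mulr1 RintegralZl//.
  rewrite !RintegralB// RintegralZl//.
  rewrite lerD2r (_ : c * dl = c / 2 * (2 * dl)); last by field.
  apply: ler_wpM2l; first by rewrite divr_ge0// ltW.
  by move: opt1 opt2 opt3; rewrite /log_growth; lra.
Qed.

End optimality.

(** * The limit of a maximizing sequence *)

Section numeraire.
Context d (T : measurableType d) (R : realType).
Variables (PP : set (probability T R)) (Q : probability T R) (g : R).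
Hypothesis ub : forall X, tame_e_variables PP X -> log_growth Q X <= g.

(** With defects [q n ^+ 2], the relative distances of consecutive e-variables
    have integrals of order [q n], which are summable. *)
Let q n : R := (2 ^ n)%:R^-1.
Let q0 n : 0 < q n. Proof. by rewrite invr_gt0 ltr0n expn_gt0. Qed.

Lemma near_optimal_sequence :
  (forall e, 0 < e -> exists2 X, tame_e_variables PP X & g - e <= log_growth Q X) ->
  exists X : nat -> T -> R,
  (forall n, tame_e_variables PP (X n)) /\ forall n, g - (q n) ^+ 2 <= log_growth Q (X n).
Proof.
move=> approx; have /choice[X XP] : forall n, exists X,
    tame_e_variables PP X /\ g - (q n) ^+ 2 <= log_growth Q X.
  by move=> n; have [|X tX opt] := approx (q n ^+ 2); [by rewrite exprn_gt0|exists X].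
by exists X; split => n; have [] := XP n.
Qed.

Variable X : nat -> T -> R.
Hypotheses (tX : forall n, tame_e_variables PP (X n))
  (opt : forall n, g - (q n) ^+ 2 <= log_growth Q (X n)).

Lemma near_optimal_cvg :
  exists S : T -> R, [/\ measurable_fun setT S, (forall w, 0 < S w) &
    {ae Q, forall w, X n w @[n --> \oo] --> S w}].
Proof.
pose v n w := `|X n w - X n.+1 w| / (X n w + X n.+1 w).
have pX n w : 0 < X n w := tame_gt0 w (tX n).
have pS n w : 0 < X n w + X n.+1 w by rewrite addr_gt0.
have mX n := tame_measurable (tX n).
have mv n : measurable_fun setT (v n).
  apply: measurable_funM.
    by apply: measurableT_comp => //; exact: measurable_funB.
  by apply: measurable_fun_inv_ge0 => [|w]; [exact: measurable_funD|exact: ltW].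
have v0 n w : 0 <= v n w by rewrite divr_ge0// ltW.
have vc n : (\int[Q]_w (v n w)%:E <= (4 / (2 ^ n.+1)%:R)%:E)%E.
  have qS : q n.+1 = q n / 2 by rewrite /q expnS natrM invfM mulrC.
  have opt1 : g - q n ^+ 2 <= log_growth Q (X n.+1).
    apply: le_trans (opt n.+1); rewrite lerD2l lerN2 qS; have := q0 n; nra.
  have qV0 : 0 < (q n)^-1 by rewrite invr_gt0.
  apply: le_trans (near_optimal_distance ub (tX n) (tX n.+1) qV0 (opt n) opt1) _.
  rewrite lee_fin invrK -/(q n.+1) qS expr2 mulKf ?gt_eqF//.
  by have := q0 n; lra.
have aecv : {ae Q, forall w, cvgn (fun n => ln (X n w))}.
  have := ae_cvg_series mv v0 (_ : 0 <= 4) vc => /(_ (ltac:(lra))).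
  by apply: filterS => w; apply: cvg_ln_of_summable.
pose L w := fine (limn_esup (fun n => (ln (X n w))%:E)).
have mL : measurable_fun setT L.
  apply: measurableT_comp => //; apply: measurable_fun_limn_esup => n.
  by apply/measurable_EFinP; exact: tame_measurable_ln (tX n).
exists (fun w => expR (L w)); split => //.
- exact: measurableT_comp.
- by move=> w; exact: expR_gt0.
apply: filterS aecv => w /cvg_ex[l lw].
have -> : L w = l.
  by rewrite /L; have [_ ->] := cvg_limn_einf_sup (cvgn_EFin lw).
rewrite (_ : (fun n => X n w) = expR \o (fun n => ln (X n w))).
  apply: continuous_cvg => //; exact: continuous_expR.
by apply/funext => n /=; rewrite lnK// posrE.
Qed.

Variable S : T -> R.
Hypotheses (mS : measurable_fun setT S) (S0 : forall w, 0 < S w)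
  (XS : {ae Q, forall w, X n w @[n --> \oo] --> S w}).

Let q_cvg : q n @[n --> \oo] --> (0 : R).
Proof.
rewrite (_ : (fun n => q n) = (fun n => 2^-1 ^+ n)).
  by apply: cvg_expr; rewrite ger0_norm//; lra.
by apply/funext => n; rewrite /q natrX exprVn.
Qed.

(** First-order optimality in the limit, the step [q n] being large compared with
    the defect [q n ^+ 2]. This makes [1 / S] the density of an effective
    measure. *)
Lemma numeraire_tame X0 : tame_e_variables PP X0 ->
  (\int[Q]_w (X0 w * (S w)^-1)%:E <= 1%:E)%E.
Proof.
move=> t0; have p0 w := tame_gt0 w t0; have m0 := tame_measurable t0.
have pX n w : 0 < X n w := tame_gt0 w (tX n).
have pS n w : 0 < X n w + q n * X0 w by rewrite addr_gt0// mulr_gt0.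
apply: (@fatou_ae _ _ _ Q (fun n w => X0 w / (X n w + q n * X0 w)) _
  (fun n => 1 + q n ^+ 2 / q n)).
- move=> n; apply: measurable_funM => //; apply: measurable_fun_inv_ge0 => [|w]; last exact: ltW.
  by apply: measurable_funD; [exact: tame_measurable (tX n)|exact: measurable_funM].
- by move=> n w; rewrite divr_ge0// ltW.
- by apply: measurable_funM => //; apply: measurable_fun_inv_ge0 => // w; exact: ltW.
- by move=> w; rewrite divr_ge0// ltW.
- apply: filterS XS => w Xw; apply: cvgM; first exact: cvg_cst.
  apply: cvgV; first by rewrite gt_eqF.
  rewrite -[X in _ --> X](addr0 (S w)) -[X in _ + X](mul0r (X0 w)).
  by apply: cvgD => //; apply: cvgM => //; exact: cvg_cst.
- by move=> n; exact: (near_optimal_ratio ub (tX n) t0 (q0 n) (opt n)).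
- rewrite -[X in _ --> X]addr0; apply: cvgD; first exact: cvg_cst.
  rewrite (_ : (fun n => _) = q)//.
  by apply/funext => n; rewrite expr2 mulfK// gt_eqF.
Qed.

(** Fatou's lemma needs a lower bound on [ln (X n w)], which adding [s] times the
    e-variable 1 provides; by [log_sum_bound] this costs at most [s]. *)
Lemma numeraire_log : (\int[Q]_w lne (S w)%:E <= g%:E)%E.
Proof.
apply/lee_addgt0Pr => s s0; rewrite -EFinD.
have pX n w : 0 < X n w := tame_gt0 w (tX n).
have lnSs w : ln s <= ln (S w + s) by rewrite ler_ln ?posrE ?addr_gt0// lerDr ltW.
have mSs : measurable_fun setT (fun w => ln (S w + s)).
  by apply: (measurableT_comp (@measurable_ln R)); exact: measurable_funD.
have mh : measurable_fun setT (fun w => ln (S w + s) - ln s) by exact: measurable_funB.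
have intc : Q.-integrable setT (EFin \o cst (ln s)) by exact: finite_measure_integrable_cst.
have bound : (\int[Q]_w (ln (S w + s) - ln s)%:E <= (g + s - ln s)%:E)%E.
  apply: (@fatou_ae _ _ _ Q (fun n w => ln (X n w + s * (cst 1 w)) - ln s) _
    (fun n => g + s - ln s)).
  - move=> n; apply: measurable_funB => //; apply: (measurableT_comp (@measurable_ln R)).
    by apply: measurable_funD; [exact: tame_measurable (tX n)|exact: measurable_funM].
  - by move=> n w; rewrite /= mulr1 subr_ge0 ler_ln ?posrE ?addr_gt0// lerDr ltW.
  - exact: mh.
  - by move=> w; rewrite subr_ge0.
  - apply: filterS XS => w Xw; apply: cvgB; last exact: cvg_cst.
    apply: continuous_cvg; first by apply: continuous_ln; rewrite addr_gt0.
    by rewrite /= mulr1; apply: cvgD => //; exact: cvg_cst.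
  - move=> n; have [intn len] := log_sum_bound ub (tX n) (tame1 PP) s0.
    apply: (@integral_le_Rintegral _ _ _ Q _ _ _ _ _ (fun w => lexx _)).
    + apply: measurable_funB => //; apply: (measurableT_comp (@measurable_ln R)).
      by apply: measurable_funD; [exact: tame_measurable (tX n)|exact: measurable_funM].
    + by move=> w; rewrite /= mulr1 subr_ge0 ler_ln ?posrE ?addr_gt0// lerDr ltW.
    + exact: (@integrableB _ _ _ Q _ measurableT _ _ intn intc).
    + rewrite RintegralB// Rintegral_cst//= probability_setT/=.
      by move: len; rewrite /= mulr1 mulr1; lra.
  - exact: cvg_cst.
have inth : Q.-integrable setT (EFin \o (fun w => ln (S w + s) - ln s)).
  apply/integrableP; split; first exact/measurable_EFinP.
  under eq_integral do rewrite /= ger0_norm ?subr_ge0//.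
  exact: le_lt_trans bound (ltry _).
apply: (@le_trans _ _ (\int[Q]_w (ln (S w + s))%:E)%E).
  apply: measurable_le_integral => [| |w].
  - exact/measurable_fun_lne/measurable_EFinP.
  - exact/measurable_EFinP.
  - by rewrite lne_EFin// lee_fin ler_ln ?posrE ?addr_gt0// lerDl ltW.
have -> : (\int[Q]_w (ln (S w + s))%:E =
    \int[Q]_w (ln (S w + s) - ln s)%:E + (ln s)%:E)%E.
  rewrite -[X in (_ + X)%E](mule1 (ln s)%:E).
  rewrite -[X in (_ + _ * X)%E](@probability_setT _ _ _ Q).
  rewrite -(integral_cst Q measurableT) -integralD//.
  by apply: eq_integral => w _; rewrite -EFinD subrK.
by rewrite -leeBrDr// -EFinB.
Qed.

End numeraire.

(** * Strong duality for one probability measure *)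

Section strong_duality.
Import HBNNSimple.
Local Open Scope charge_scope.
Context d (T : measurableType d) (R : realType).
Implicit Types (PP : set (probability T R)) (Q : probability T R).
Local Open Scope ereal_scope.

Lemma tame_expected_log PP Q (X : T -> R) : tame_e_variables PP X ->
  expected_log Q (EFin \o X) = (log_growth Q X)%:E.
Proof.
move=> tX; have int := tame_integrable_ln Q tX.
have E : (fun w => lne ((EFin \o X) w)) = EFin \o (fun w => ln (X w)).
  by apply/funext => w; exact: lne_EFin (tame_gt0 w tX).
rewrite /expected_log E.
have := integral_funeneg_lt_pinfty measurableT int; case: eqVneq => [->//|_ _].
by rewrite -integralE /log_growth fineK//; exact: integrable_fin_num int.
Qed.

Lemma tame_bounded_e_variable PP (X : T -> R) : tame_e_variables PP X ->
  bounded_e_variables PP (EFin \o X).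
Proof.
move=> tX; have [mX [e e0 [M eXM]] XP] := tX; split.
  split => //; first exact/measurable_EFinP.
  by move=> w; rewrite lee_fin ltW// (tame_gt0 w tX).
apply: le_lt_trans (ltry M); apply: ge_ereal_sup => _ [w _ <-].
by rewrite lee_fin; case/andP: (eXM w).
Qed.

(** An integral is the supremum of the integrals of the simple functions [h]
    below the integrand, and mixing [h] with a small constant [a] makes it
    tame. *)
Lemma effective_of_tame PP (mu : {finite_measure set T -> \bar R}) :
  (forall X, tame_e_variables PP X -> \int[mu]_w (X w)%:E <= 1) -> effective_null PP mu.
Proof.
move=> tle X [mX X0 XP] /=.
rewrite ge0_integralTE//; apply: ge_ereal_sup => _ [h /= hX <-].
rewrite -integralT_nnsfun.
have mh : measurable_fun setT (fun w => (h w)%:E) by exact/measurable_EFinP.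
have mhZ (r : R) : measurable_fun setT (fun w => (r * h w)%:E).
  by apply/measurable_EFinP; exact: measurable_funM.
have h0 w : (0 <= h w)%R by exact: fun_ge0.
have h0E w : 0 <= (h w)%:E by rewrite lee_fin.
have [M hM] : exists M, forall w, (h w <= M)%R.
  have [M [_ hM]] := simple_bounded h; exists (M + 1)%R => w.
  by rewrite (le_trans (ler_norm _))// hM// ltrDl.
have scaled a : (0 < a < 1)%R -> (1 - a)%:E * \int[mu]_w (h w)%:E <= 1.
  move=> /andP[a0 a1].
  have b0 : (0 <= 1 - a)%R by rewrite subr_ge0 ltW.
  rewrite -ge0_integralZl//.
  apply: (@le_trans _ _ (\int[mu]_w ((1 - a) * h w + a)%:E)).
    apply: ge0_le_integral => //.
    - by move=> w _; rewrite -EFinM lee_fin mulr_ge0.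
    - exact: mhZ.
    - by apply/measurable_EFinP; apply: measurable_funD => //; exact: measurable_funM.
    - by move=> w _; rewrite -EFinM lee_fin lerDl ltW.
  apply: tle; split.
  - by apply: measurable_funD => //; exact: measurable_funM.
  - exists a => //; exists ((1 - a) * M + a)%R => w.
    by rewrite lerDr mulr_ge0//= lerD2r ler_wpM2l.
  - move=> P PPP; under eq_integral do rewrite EFinD.
    rewrite ge0_integralD//; [|by move=> w _; rewrite lee_fin mulr_ge0
                              |by move=> w _; rewrite lee_fin ltW].
    under eq_integral do rewrite EFinM.
    rewrite ge0_integralZl//.
    have -> : \int[P]_w a%:E = a%:E.
      by rewrite (integral_cst P measurableT a%:E) /= probability_setT mule1.
    have hP : \int[P]_w (h w)%:E <= 1.
      by apply: le_trans (XP P PPP); apply: ge0_le_integral => // w _; rewrite lee_fin.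
    apply: (@le_trans _ _ ((1 - a)%:E * 1 + a%:E)); last by rewrite mule1 -EFinD subrK.
    by rewrite leeD2r// lee_wpmul2l.
have I0 : 0 <= \int[mu]_w (h w)%:E by apply: integral_ge0 => w _; rewrite lee_fin.
move: scaled I0; case: (\int[mu]_w _) => [r| |]// scaled r0; last first.
  by have := scaled 2^-1%R (ltac:(lra)); rewrite gt0_muley// lte_fin; lra.
rewrite lee_fin leNgt; apply/negP => r1.
have r0' : (0 < r)%R by lra.
have /scaled : (0 < (r - 1) / (2 * r) < 1)%R.
  by rewrite divr_gt0 ?subr_gt0 ?mulr_gt0//= ltr_pdivrMr ?mulr_gt0//; lra.
rewrite -EFinM lee_fin (_ : (1 - _) * r = (r + 1) / 2)%R; first by lra.
by field; rewrite gt_eqF.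
Qed.

(** The effective measure is [Q] divided by the limit [S] of a maximizing
    sequence; the density of [Q] in it is [S]. *)
Lemma strong_duality PP Q (g : R) :
  (forall X, tame_e_variables PP X -> (log_growth Q X <= g)%R) ->
  (forall e, (0 < e)%R ->
     exists2 X, tame_e_variables PP X & (g - e <= log_growth Q X)%R) ->
  exists2 P, effective_null PP P & relative_entropy Q P <= g%:E.
Proof.
move=> ub supg; have [X [tX opt]] := near_optimal_sequence supg.
have [S [mS S0 XS]] := near_optimal_cvg ub tX opt.
pose Y w := ((S w)^-1)%R.
have mY : measurable_fun setT Y by apply: measurable_fun_inv_ge0 => // w; exact: ltW.
have Y0 w : (0 <= Y w)%R by rewrite invr_ge0 ltW.
have tY X0 : tame_e_variables PP X0 -> \int[Q]_w (X0 w * Y w)%:E <= 1.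
  exact: (numeraire_tame ub tX opt mS S0 XS).
have intY : \int[Q]_w (Y w)%:E < +oo.
  have := tY _ (tame1 PP); under eq_integral do rewrite /= mul1r.
  by move=> /le_lt_trans; apply; exact: ltry.
pose P := finite_density_measure mY Y0 intY.
exists P.
  apply: effective_of_tame => X0 t0.
  rewrite integral_density//; [exact: tY|exact/measurable_EFinP/(tame_measurable t0)|].
  by move=> w; rewrite lee_fin ltW// (tame_gt0 w t0).
have SP A : measurable A -> Q A = \int[P]_(w in A) (S w)%:E.
  move=> mA; rewrite integral_density//; [|exact/measurable_EFinP|].
    under eq_integral do rewrite -EFinM mulfV ?gt_eqF//.
    by rewrite integral_cst// mul1e.
  by move=> w; rewrite lee_fin ltW.
have QP : Q `<< P.
  apply/null_content_dominatesP => A mA PA; rewrite SP//.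
  by apply: null_set_integral => //; apply/measurable_funTS/measurable_EFinP.
have RNE : ae_eq P setT ('d (charge_of_finite_measure Q) '/d P) (EFin \o S).
  apply: integral_ae_eq; [by []|exact: Radon_Nikodym_integrable|exact/measurable_EFinP|].
  by move=> A _ mA; rewrite -Radon_Nikodym_integral//; exact: SP.
rewrite /relative_entropy; case: asboolP => // _.
rewrite (ae_eq_integral (fun w => lne (S w)%:E))//.
- exact: (numeraire_log ub tX mS S0 XS).
- exact: measurable_fun_lne.
- exact/measurable_fun_lne/measurable_EFinP.
- by have := null_dominates_ae_eq measurableT QP RNE; apply: filterS => w /= + _ => ->.
Qed.

End strong_duality.

(** * The minimax theorem *)

Section value.
Local Open Scope ereal_scope.
Context d (T : measurableType d) (R : realType).
Implicit Types (PP QQ : set (probability T R)) (Q : probability T R).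

Definition tame_growth PP Q : \bar R :=
  ereal_sup [set (log_growth Q X)%:E | X in tame_e_variables PP].

Lemma tame_growth_minimum PP Q : PP !=set0 ->
  is_minimum [set relative_entropy Q P | P in effective_null PP] (tame_growth PP Q).
Proof.
move=> [P0 PP0].
have lb P : effective_null PP P -> tame_growth PP Q <= relative_entropy Q P.
  move=> effP; apply: ge_ereal_sup => _ [X tX <-].
  rewrite -(tame_expected_log Q tX); apply: weak_duality effP.
  by have [] := tame_bounded_e_variable tX.
split; last by move=> _ [P effP <-]; exact: lb.
have effP0 : effective_null PP P0 by move=> X [_ _]; exact.
case E : (tame_growth PP Q) => [g| |].
- have [|e e0|P effP leP] := @strong_duality _ _ _ PP Q g.
  + by move=> X tX; rewrite -lee_fin -E; apply: ereal_sup_ubound; exists X.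
  + have : (g - e)%:E < tame_growth PP Q by rewrite E lte_fin ltrBlDr ltrDl.
    by move/ereal_sup_gt => [_ [X tX <-]]; rewrite lte_fin => /ltW; exists X.
  exists P => //; apply/eqP; rewrite eq_le leP/= -E; exact: lb.
- by exists P0 => //; apply/eqP; rewrite -leye_eq -E; exact: lb.
- have : 0 <= tame_growth PP Q.
    by apply: ereal_sup_ubound; exists (cst 1%R); [exact: tame1|rewrite log_growth1].
  by rewrite E.
Qed.

End value.

Local Open Scope ereal_scope.

Theorem theorem4p17 (d : measure_display) (T : measurableType d) (R : realType)
  (PP QQ : set (probability T R))
  (PP_nonempty : PP !=set0)
  (QQ_nonempty : QQ !=set0)
  (QQ_convex : convex_probabilities QQ)
  (QQ_compact : setwise_compact QQ) :
  let G := maxmin_log_growth (e_variables PP) QQ in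
  let Gb := maxmin_log_growth (bounded_e_variables PP) QQ in
  G = Gb /\
  exists h : probability T R -> \bar R,
    (forall Q, QQ Q ->
       is_minimum [set relative_entropy Q P | P in effective_null PP] (h Q)) /\
    is_minimum [set h Q | Q in QQ] G.
Proof.
move=> G Gb.
have minh Q := tame_growth_minimum Q PP_nonempty.
have GbG : Gb <= G.
  by apply: le_ereal_sup => _ [X [eX _] <-]; exists X.
have Gh Q : QQ Q -> G <= tame_growth PP Q.
  move=> QQQ; apply: ge_ereal_sup => _ [X eX <-].
  have [[P effP <-] _] := minh Q.
  apply: le_trans (weak_duality Q eX effP).
  by apply: ereal_inf_lbound; exists Q.
have tame_le X c : tame_e_variables PP X ->
    (forall Q, QQ Q -> (c <= log_growth Q X)%R) -> c%:E <= Gb.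
  move=> tX cX; apply: le_trans (ereal_sup_ubound _); last first.
    by exists (EFin \o X); [exact: tame_bounded_e_variable|reflexivity].
  apply: le_ereal_inf_tmp => _ [Q QQQ <-].
  by rewrite (tame_expected_log Q tX) lee_fin cX.
have [Q0 QQ0 hGb] : exists2 Q, QQ Q & tame_growth PP Q <= Gb.
  apply: contrapT => noQ.
  have Gbh Q : QQ Q -> Gb < tame_growth PP Q.
    by move=> QQQ; rewrite ltNge; apply/negP => le; apply: noQ; exists Q.
  have Gb0 : 0 <= Gb.
    by apply: tame_le (tame1 PP) _ => Q _; rewrite log_growth1.
  case: Gb Gbh Gb0 tame_le {GbG noQ} => [c| |]// Gbh _ tame_le; last first.
    by have [Q QQQ] := QQ_nonempty; have := Gbh Q QQQ; rewrite ltNge leey.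
  have [Q QQQ|c' cc' [X tX Xc']] :=
    @log_growth_minimax _ _ _ PP QQ c QQ_convex QQ_compact.
    by have /ereal_sup_gt[_ [X tX <-]] := Gbh Q QQQ; rewrite lte_fin; exists X.
  by have := tame_le X c' tX Xc'; rewrite lee_fin leNgt cc'.
have G0 : G = tame_growth PP Q0.
  by apply/eqP; rewrite eq_le Gh//= (le_trans hGb).
split; first by apply/eqP; rewrite eq_le GbG andbT G0.
exists (tame_growth PP); split => [Q _|]; first exact: minh.
by split; [exists Q0|move=> _ [Q QQQ <-]; exact: Gh].
Qed.
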